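(* Let $K=\{k_1,\dots,k_N\}\subset\mathbb Z^3$, $N\ge1$, and assume that the forcing is complex phase-complete on $K$, i.e. $\mathscr W_0=\operatorname{span}_{\mathbb R}\{e_k,\mathrm ie_k:k\in K\}$. Then $$\mathscr W_\infty=\operatorname{span}_{\mathbb C}\{e_\ell:\ell\in\mathcal C_K\}.$$ Consequently, for every finite $s$, $$\overline{\mathscr W_\infty}^{\,H^s}=H^s_{\mathcal C_K}(\mathbb T^3;\mathbb C):=\{u\in H^s:\widehat u(\ell)=0\text{ for }\ell\notin\mathcal C_K\}.$$ In particular, the following are equivalent: (i) the forcing is cubic saturating; (ii) $\Lambda_K=\mathbb Z^3$; (iii) there are no nonzero $\vartheta\in\mathbb T^3$ and $c\in\mathbb S^1$ such that $\mathrm e^{\mathrm ik\cdot\vartheta}=c$ for every $k\in K$. If $0\in K$, the common phase $c$ in (iii) is necessarily $c=1$.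
   Context: $\mathbb T^3=(\mathbb R/2\pi\mathbb Z)^3$, $e_k(x)=\mathrm e^{\mathrm ik\cdot x}$, $\mathbb S^1=\{c\in\mathbb C:|c|=1\}$, and $H^s=H^s(\mathbb T^3;\mathbb C)$. Put $\Lambda_K=\operatorname{span}_{\mathbb Z}\{k-k':k,k'\in K\}$ and $\mathcal C_K=k^\circ+\Lambda_K$ for any $k^\circ\in K$ (the coset is independent of the choice of $k^\circ$). The forcing is given by finitely many profiles whose real span is $\mathscr W_0$. Let $\mathsf N(z)=|z|^2z$, $\mathsf Jz=\mathrm iz$, with third real derivative $D^3\mathsf N[h,k,\ell]=2(hk\bar\ell+h\ell\bar k+k\ell\bar h)$. Recursively, $$\mathscr W_{n+1}=\operatorname{span}_{\mathbb R}\bigl(\mathscr W_n\cup\{\mathsf JD^3\mathsf N[\phi,h,k]:\phi\in\mathscr W_n,\ h,k\in\mathscr W_0\}\bigr),\qquad\mathscr W_\infty=\bigcup_{n\ge0}\mathscr W_n.$$ The forcing is cubic saturating if $\mathscr W_\infty$ is dense in $H^1$. *)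

(* Defs.v *)
From HB Require Import structures.
From mathcomp Require Import all_boot all_order all_algebra.
From mathcomp Require Import complex ring.
From mathcomp Require Import all_classical all_reals all_analysis.

Set Implicit Arguments.
Unset Strict Implicit.
Unset Printing Implicit Defensive.

Import Order.TTheory GRing.Theory Num.Theory.
Import numFieldNormedType.Exports.

Local Open Scope classical_set_scope.
Local Open Scope ring_scope.
Local Open Scope complex_scope.

(* Span of [A] with coefficients restricted to the scalars in [S], so that a
   complex vector space can be given both its real and its complex spans. *)
Definition span_over (F : pzRingType) (V : lmodType F) (S : set F)
    (A : set V) : set V :=
  [set v | exists n (c : 'I_n -> F) (w : 'I_n -> V),
     (forall i, S (c i)) /\ (forall i, A (w i)) /\
     v = \sum_(i < n) c i *: w i].

Definition Lambda (K : set 'rV[int]_3) : set 'rV[int]_3 :=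
  span_over setT [set d | exists k k', K k /\ K k' /\ d = k - k'].

Definition coset (K : set 'rV[int]_3) (k0 : 'rV[int]_3) : set 'rV[int]_3 :=
  [set k0 + l | l in Lambda K].

Section Torus.
Variable R : realType.
Local Notation C := R[i].
Local Notation mu := (@lebesgue_measure R).

(* The torus is R^3 modulo (2 pi Z)^3: its points are represented by vectors
   of R^3, and the functions on it are the periodic functions on R^3. *)
Local Notation pt := 'rV[R]_3.

Definition period (m : 'rV[int]_3) : pt := (2 * pi) *: map_mx intr m.

Definition torus_fun (f : pt -> C) : Prop := forall m, periodic f (period m).

Definition zero_on_torus (x : pt) : Prop := exists m, x = period m.

Definition dot (k : 'rV[int]_3) (x : pt) : R :=
  \sum_(i < 3) (k 0 i)%:~R * x 0 i.

Definition expi (t : R) : C := cos t +i* sin t.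

Definition mode (k : 'rV[int]_3) : pt -> C := fun x => expi (dot k x).

Definition real_span : set (pt -> C) -> set (pt -> C) :=
  span_over [set z : C | z \is Num.real].

Definition complex_span : set (pt -> C) -> set (pt -> C) := span_over setT.

Definition phase_complete (W0 : set (pt -> C)) (K : set 'rV[int]_3) : Prop :=
  W0 = real_span [set f | exists2 k, K k & f = mode k \/ f = 'i *: mode k].

Definition cubic (z : C) : C := `|z| ^+ 2 * z.

(* Third real derivative of [cubic]; see [D3cubicE] below. *)
Definition D3cubic (h k l : C) : C :=
  2 * (h * k * l^* + h * l * k^* + k * l * h^*).

(* For the homogeneous cubic map [cubic], the third derivative is its full
   polarization. *)
Lemma D3cubicE (h k l : C) :
  D3cubic h k l =
    cubic (h + k + l) - cubic (h + k) - cubic (h + l) - cubic (k + l)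
    + cubic h + cubic k + cubic l.
Proof.
have E (z : C) : cubic z = z * z * z^*.
  by rewrite /cubic sqr_normc mulrAC.
rewrite !E !rmorphD /= /D3cubic; ring.
Qed.

Fixpoint sat_space (W0 : set (pt -> C)) (n : nat) : set (pt -> C) :=
  if n is n'.+1 then
    real_span (sat_space W0 n' `|`
      [set f | exists p h k, sat_space W0 n' p /\ W0 h /\ W0 k /\
         f = fun x => 'i * D3cubic (p x) (h x) (k x)])
  else W0.

Definition sat_limit (W0 : set (pt -> C)) : set (pt -> C) :=
  \bigcup_n sat_space W0 n.

Definition partial (i : 'I_3) (g : pt -> R) : pt -> R := 'D_(delta_mx 0 i) g.

Definition partials (a : seq 'I_3) (g : pt -> R) : pt -> R :=
  foldr partial g a.

Definition smooth (g : pt -> R) : Prop :=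
  forall a, continuous (partials a g) /\
    forall i x, derivable (partials a g) x (delta_mx 0 i).

(* C^oo(T^3; C), tested on real and imaginary parts. *)
Record test_fun := TestFun {
  test_val :> pt -> C;
  test_periodic : torus_fun test_val;
  test_smooth_Re : smooth (fun x => complex.Re (test_val x));
  test_smooth_Im : smooth (fun x => complex.Im (test_val x)) }.

Definition cpartials (a : seq 'I_3) (f : pt -> C) : pt -> C := fun x =>
  partials a (fun y => complex.Re (f y)) x
  +i* partials a (fun y => complex.Im (f y)) x.

(* The periodic distributions: complex-linear functionals on test functions
   that are bounded by a C^m norm for some m. *)
Definition torus_distribution (u : test_fun -> C) : Prop :=
  (forall (a b : C) (f g h : test_fun),
     (forall x, h x = a * f x + b * g x) -> u h = a * u f + b * u g) /\
  (exists (B : R) (m : nat), forall (f : test_fun) (M : R),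
     (forall (a : seq 'I_3) x, (size a <= m)%N ->
        `|cpartials a f x| <= M%:C) ->
     `|u f| <= (B * M)%:C).

Definition vec3 (x y z : R) : pt := \row_(i < 3) nth 0 [:: x; y; z] i.

(* Integral over one fundamental cell, used for continuous integrands only. *)
Definition torus_Rint (g : pt -> R) : R :=
  \int[mu]_(x in `[0, 2 * pi])
    \int[mu]_(y in `[0, 2 * pi])
      \int[mu]_(z in `[0, 2 * pi]) g (vec3 x y z).

Definition torus_int (f : pt -> C) : C :=
  torus_Rint (fun x => complex.Re (f x))
  +i* torus_Rint (fun x => complex.Im (f x)).

Definition regular (w : pt -> C) (f : test_fun) : C :=
  torus_int (fun x => w x * f x).

Section ModeSmooth.
Variable k : 'rV[int]_3.

Let wave (a b : R) : pt -> R := fun x => a * cos (dot k x) + b * sin (dot k x).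

Let differentiable_dot x : differentiable (dot k) x.
Proof.
rewrite (_ : dot k = \sum_(i < 3) (fun y : pt => (k 0 i)%:~R * y 0 i)).
  apply: differentiable_sum => i.
  apply: differentiableM => //; exact: differentiable_coord.
by apply/funext => y; rewrite /dot fct_sumE.
Qed.

Let dot_is_derive i x : is_derive x (delta_mx 0 i) (dot k) (k 0 i)%:~R.
Proof.
apply: DeriveDef; first exact: diff_derivable.
rewrite /derive.
apply: cvg_lim => //.
apply: cvg_near_cst.
near=> h.
have h0 : h != 0 by near: h; exact: nbhs_dnbhs_neq.
rewrite /= /dot -sumrB (bigD1 i) //= big1 => [|j ji].
  by rewrite !mxE !eqxx /= addr0 mulr1 mulrDr addrK /GRing.scale /= mulrC mulfK.
by rewrite !mxE eqxx (negbTE ji) /= mulr0 add0r subrr.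
Unshelve. all: by end_near. Qed.

Let wave_diff a b x : differentiable (wave a b) x.
Proof.
apply: differentiableD; apply: differentiableM => //;
  apply: (differentiable_comp (differentiable_dot x));
  apply/derivable1_diffP.
- exact: derivable_cos.
- exact: derivable_sin.
Qed.

Let partial_wave a b i :
  partial i (wave a b) = wave (b * (k 0 i)%:~R) (- a * (k 0 i)%:~R).
Proof.
have comp (g : R -> R) y : derivable g (dot k y) 1 ->
    is_derive y (delta_mx 0 i) (g \o dot k) ((k 0 i)%:~R * 'D_1 g (dot k y)).
  move=> /derivable1_diffP dg.
  have dgk := differentiable_comp (differentiable_dot y) dg.
  apply: DeriveDef; first exact: diff_derivable.
  rewrite deriveE // diff_comp //= -[in LHS](deriveE _ (differentiable_dot y)).
  rewrite (@derive_val _ _ _ _ _ _ _ (dot_is_derive i y)) //.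
  by rewrite -[X in 'd g _ X]mulr1 linearZ /= -deriveE.
apply/funext => y; rewrite /partial /wave.
have dc := comp _ _ (@derivable_cos R (dot k y)).
have ds := comp _ _ (@derivable_sin R (dot k y)).
rewrite (_ : (fun _ => _) = a *: (cos \o dot k) + b *: (sin \o dot k)) //.
rewrite derive_val /= !derive_val /GRing.scale /=; ring.
Qed.

Let smooth_wave a b : smooth (wave a b).
Proof.
move=> s.
have [a' [b' ->]] : exists a' b', partials s (wave a b) = wave a' b'.
  elim: s => [|i s [a' [b' IH]]]; first by exists a, b.
  by rewrite /= IH partial_wave; eexists; eexists.
split=> [x|i x]; first exact: differentiable_continuous.
exact: diff_derivable.
Qed.

Lemma mode_periodic : torus_fun (mode k).
Proof.
move=> m x; rewrite /mode.
have -> : dot k (x + period m) =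
    dot k x + (pi *+ 2) *~ (\sum_(i < 3) k 0 i * m 0 i).
  rewrite /dot -mulrzr rmorph_sum mulr_sumr -big_split /=.
  by apply: eq_bigr => i _; rewrite !mxE rmorphM /= -mulr_natl; ring.
have expiD t (n : nat) : expi (t + pi *+ 2 *+ n) = expi t.
  by rewrite /expi (periodicn (@cosD2pi R)) (periodicn (@sinD2pi R)).
case: (\sum_(i < 3) _) => n; first by rewrite -pmulrn expiD.
by rewrite NegzE mulrNz -pmulrn -[in RHS](subrK (pi *+ 2 *+ n.+1) (dot k x)) expiD.
Qed.

Lemma mode_smooth_Re : smooth (fun x => complex.Re (mode k x)).
Proof.
rewrite (_ : (fun _ => _) = wave 1 0); first exact: smooth_wave.
by apply/funext => x; rewrite /wave mul1r mul0r addr0.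
Qed.

Lemma mode_smooth_Im : smooth (fun x => complex.Im (mode k x)).
Proof.
rewrite (_ : (fun _ => _) = wave 0 1); first exact: smooth_wave.
by apply/funext => x; rewrite /wave mul1r mul0r add0r.
Qed.

Definition mode_test : test_fun :=
  TestFun mode_periodic mode_smooth_Re mode_smooth_Im.

End ModeSmooth.

Definition fourier (u : test_fun -> C) (l : 'rV[int]_3) : C :=
  (((2 * pi) ^- 3)%:C) * u (mode_test (- l)).

Definition sobolev_norm (s : R) (u : test_fun -> C) : \bar R :=
  poweR (\esum_(l in [set: 'rV[int]_3])
    ((1 + \sum_(i < 3) (l 0 i)%:~R ^+ 2) `^ s
      * (complex.Re (fourier u l) ^+ 2 + complex.Im (fourier u l) ^+ 2))%:E)
    2^-1.

(* H^s, for real s of either sign, as a space of periodic distributions. *)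
Definition Sobolev (s : R) : set (test_fun -> C) :=
  [set u | torus_distribution u /\ (sobolev_norm s u < +oo)%E].

(* Closure in H^s of a set of functions on the torus, each of which acts as a
   regular distribution. *)
Definition Sobolev_closure (s : R) (W : set (pt -> C)) : set (test_fun -> C) :=
  [set u | Sobolev s u /\ forall e : R, 0 < e ->
     exists2 w, W w & (sobolev_norm s (fun f => (u f - regular w f)%R) < e%:E)%E].

Definition Sobolev_supported (s : R) (A : set 'rV[int]_3) :
    set (test_fun -> C) :=
  [set u | Sobolev s u /\ forall l, ~ A l -> fourier u l = 0].

Definition cubic_saturating (W0 : set (pt -> C)) : Prop :=
  Sobolev_closure 1 (sat_limit W0) = Sobolev 1.

Definition common_phase (K : set 'rV[int]_3) (x : pt) (c : C) : Prop :=
  ~ zero_on_torus x /\ `|c| = 1 /\ forall k, K k -> mode k x = c.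

End Torus.

(* Main.v *)
Require Import Defs.
From HB Require Import structures.
From mathcomp Require Import all_boot all_order all_algebra.
From mathcomp Require Import complex ring lra zify.
From mathcomp Require Import all_classical all_reals all_analysis.

Set Implicit Arguments.
Unset Strict Implicit.
Unset Printing Implicit Defensive.

Import Order.TTheory GRing.Theory Num.Theory.
Import numFieldNormedType.Exports.

Local Open Scope classical_set_scope.
Local Open Scope ring_scope.
Local Open Scope complex_scope.

(* The modes [e_l] with [l] in the coset [C_K] are closed under the third
   derivative of the cubic, because [e_a e_b conj(e_c) = e_(a + b - c)]. Since
   [W_0] contains [e_k] and [i e_k], polarizing over these phases isolates
   each product, so [e_a] reaches [e_(a + k - k')] for all [k], [k'] in [K],
   hence all of the coset. Density in [H^s] is truncation of Fourier series; conversely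
   orthogonality of the modes shows that limits keep vanishing coefficients off
   the coset. A common phase is a nontrivial character of [Z^3 / Lambda_K]; one
   exists unless this quotient is trivial, by the Smith normal form. *)

(** * Spans with restricted scalars *)

Lemma span_over_subset (F : pzRingType) (V : lmodType F) (S : set F)
    (A : set V) : S 1 -> A `<=` span_over S A.
Proof.
move=> S1 v Av; exists 1, (fun=> 1), (fun=> v); do 2!split=> //.
by rewrite big_ord1 scale1r.
Qed.

Lemma span_over0 (F : pzRingType) (V : lmodType F) (S : set F) (A : set V) :
  span_over S A 0.
Proof.
have F0 (P : Type) : 'I_0 -> P by case.
exists 0, (F0 _), (F0 _); rewrite big_ord0; by split; [case|split; [case|]].
Qed.

Lemma span_overD (F : pzRingType) (V : lmodType F) (S : set F) (A : set V) u v :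
  span_over S A u -> span_over S A v -> span_over S A (u + v).
Proof.
move=> [m [c [w [Sc [Aw ->]]]]] [n [d [z [Sd [Az ->]]]]].
exists (m + n)%N,
  (fun i => match fintype.split i with inl j => c j | inr j => d j end),
  (fun i => match fintype.split i with inl j => w j | inr j => z j end).
split; first by move=> i; case: fintype.split.
split; first by move=> i; case: fintype.split.
rewrite big_split_ord /=; congr +%R; apply: eq_bigr => i _.
  by rewrite (unsplitK (inl i)).
by rewrite (unsplitK (inr i)).
Qed.

Lemma span_overZ (F : pzRingType) (V : lmodType F) (S : set F) (A : set V) a u :
    (forall b, S b -> S (a * b)) ->
  span_over S A u -> span_over S A (a *: u).
Proof.
move=> Sa [m [c [w [Sc [Aw ->]]]]]; exists m, (fun i => a * c i), w.
split; first by move=> i; apply: Sa.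
by split=> //; rewrite scaler_sumr; apply: eq_bigr => i _; rewrite scalerA.
Qed.

Lemma span_over_ind (F : pzRingType) (V : lmodType F) (S : set F)
    (A P : set V) :
    P 0 -> (forall u v, P u -> P v -> P (u + v)) ->
    (forall a u, S a -> A u -> P (a *: u)) ->
  span_over S A `<=` P.
Proof.
move=> P0 PD PA _ [m [c [w [Sc [Aw ->]]]]].
by elim/big_ind : _ => // i _; apply: PA.
Qed.

(** * The difference lattice and its coset *)

Section LambdaCoset.
Variable K : set 'rV[int]_3.

Lemma LambdaD l m : Lambda K l -> Lambda K m -> Lambda K (l + m).
Proof. exact: span_overD. Qed.

Lemma LambdaZ a l : Lambda K l -> Lambda K (a *: l).
Proof. exact: span_overZ. Qed.

Lemma LambdaN l : Lambda K l -> Lambda K (- l).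
Proof. by rewrite -scaleN1r; exact: LambdaZ. Qed.

Lemma Lambda_sub k k' : K k -> K k' -> Lambda K (k - k').
Proof. by move=> Kk Kk'; apply: span_over_subset => //; exists k, k'. Qed.

(** An integer multiple of a difference unrolls into single steps, and a negative one swaps [k] and
    [k']. A single difference is what one stage of the saturation recursion can add to a
    frequency. *)
Lemma Lambda_ind (P : set 'rV[int]_3) :
    P 0 -> (forall l k k', P l -> K k -> K k' -> P (l + (k - k'))) ->
  Lambda K `<=` P.
Proof.
(* Quantifying over the base point [m] makes the claim stable under sums of [l], which [P] itself
   need not be. *)
move=> P0 Pstep l Ll; suff: forall m, P m -> P (m + l).
  by move=> /(_ 0 P0); rewrite add0r.
move: l Ll; apply: span_over_ind
  => [m|u v IHu IHv m Pm|a d _ [k [k' [Kk [Kk' ->]]]] m Pm].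
- by rewrite addr0.
- by rewrite addrA; apply/IHv/IHu.
have Pn n : P (m + (k - k') *+ n) /\ P (m - (k - k') *+ n).
  elim: n => [|n [IHp IHn]]; first by rewrite !mulr0n subr0 addr0.
  rewrite !mulrSr opprD !addrA; split.
    by have := Pstep _ _ _ IHp Kk Kk'; rewrite addrA.
  have := Pstep _ _ _ IHn Kk' Kk.
  by rewrite -[k' - k]opprB.
case: a => n; first by rewrite -natz scaler_nat; case: (Pn n).
by have [_ PnN] := Pn n.+1; rewrite NegzE scaleNr -natz scaler_nat.
Qed.

Lemma coset_mem k0 k : K k0 -> K k -> coset K k0 k.
Proof.
by move=> Kk0 Kk; exists (k - k0); [exact: Lambda_sub|rewrite addrC subrK].
Qed.

Lemma coset_subP k0 l : coset K k0 l <-> Lambda K (l - k0).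
Proof.
split=> [[d Ld <-]|Ld]; first by rewrite addrAC subrr add0r.
by exists (l - k0) => //; rewrite addrC subrK.
Qed.

Lemma cosetD k0 l m : coset K k0 l -> Lambda K m -> coset K k0 (l + m).
Proof. by rewrite !coset_subP => Ll Lm; rewrite addrAC; exact: LambdaD. Qed.

End LambdaCoset.

(** * Modes as characters *)

Section Modes.
Variable R : realType.
Local Notation C := R[i].
Local Notation pt := 'rV[R]_3.

Lemma expi0 : expi (0 : R) = 1.
Proof. by rewrite /expi cos0 sin0. Qed.

Lemma expiD (s t : R) : expi (s + t) = expi s * expi t.
Proof. by rewrite /expi cosD sinD; simpc; congr (_ +i* _); rewrite addrC. Qed.

Lemma expiN (t : R) : expi (- t) = (expi t)^*%R.
Proof. by rewrite /expi cosN sinN. Qed.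

Lemma expi_conj (t : R) : expi t * (expi t)^* = 1.
Proof. by rewrite -expiN -expiD subrr expi0. Qed.

Lemma dotD k l (x : pt) : dot (k + l) x = dot k x + dot l x.
Proof.
rewrite /dot -big_split /=; apply: eq_bigr => i _.
by rewrite !mxE rmorphD /= mulrDl.
Qed.

Lemma dotN k (x : pt) : dot (- k) x = - dot k x.
Proof.
by rewrite /dot -sumrN; apply: eq_bigr => i _; rewrite !mxE rmorphN mulNr.
Qed.

Lemma dot0 (x : pt) : dot 0 x = 0.
Proof. by rewrite /dot big1 // => i _; rewrite mxE mul0r. Qed.

Lemma modeD k l (x : pt) : mode (k + l) x = mode k x * mode l x.
Proof. by rewrite /mode dotD expiD. Qed.

Lemma modeN k (x : pt) : mode (- k) x = (mode k x)^*%R.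
Proof. by rewrite /mode dotN expiN. Qed.

Lemma mode0 (x : pt) : mode 0 x = 1.
Proof. by rewrite /mode dot0 expi0. Qed.

Lemma mode_conj k (x : pt) : mode k x * (mode k x)^* = 1.
Proof. exact: expi_conj. Qed.

End Modes.

(* In [p a b^* + p b a^* + a b p^*] the last summand is odd and the others even
   under (a, b) -> (i a, i b); the last two signed copies separate the first
   summand from the second. *)
Lemma polarization (F : fieldType) (i p a b p' a' b' : F) :
    let D x x' y y' z z' := 2 * (x * y * z' + x * z * y' + y * z * x') in
    8 != 0 :> F -> i * i = -1 ->
  i * (p * (a * b')) =
    1 / 8 * (i * D p p' a a' b b')
    + 1 / 8 * (i * D p p' (i * a) (- i * a') (i * b) (- i * b'))
    + -1 / 8 * (i * D (i * p) (- i * p') (i * a) (- i * a') b b')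
    + 1 / 8 * (i * D (i * p) (- i * p') a a' (i * b) (- i * b')).
Proof. by move=> D n0 ii; rewrite /D; field: ii. Qed.

(** * The saturated space as trigonometric polynomials on the coset *)

Section Saturation.
Variables (R : realType) (K : set 'rV[int]_3) (k0 : 'rV[int]_3).
Variable W0 : set ('rV[R]_3 -> R[i]).
Hypotheses (Kk0 : K k0) (W0K : phase_complete W0 K).
Local Notation C := R[i].
Local Notation pt := 'rV[R]_3.
Local Notation W := (sat_limit W0).
Local Notation trig := (complex_span [set (mode l : pt -> C) | l in coset K k0]).

Lemma real_spanD (A : set (pt -> C)) f g :
  real_span A f -> real_span A g -> real_span A (f + g).
Proof. exact: span_overD. Qed.

Lemma real_spanZ (A : set (pt -> C)) a f :
  a \is Num.real -> real_span A f -> real_span A (a *: f).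
Proof. by move=> ra; apply: span_overZ => b rb; exact: realM. Qed.

Lemma sub_real_span (A : set (pt -> C)) : A `<=` real_span A.
Proof. by apply: span_over_subset => /=; exact: real1. Qed.

Lemma sat_spaceS n : sat_space W0 n `<=` sat_space W0 n.+1.
Proof. by move=> f Wf; apply: sub_real_span; left. Qed.

Lemma sat_space_mono m n :
  (m <= n)%N -> sat_space W0 m `<=` sat_space W0 n.
Proof.
move=> /subnK <-; elim: (n - m)%N => [//|d IH] f /IH.
exact: sat_spaceS.
Qed.

Lemma sat_spaceD n f g :
  sat_space W0 n f -> sat_space W0 n g -> sat_space W0 n (f + g).
Proof. by case: n => [|n]; [rewrite /= W0K|]; exact: real_spanD. Qed.

Lemma sat_spaceZ n a f :
  a \is Num.real -> sat_space W0 n f -> sat_space W0 n (a *: f).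
Proof. by case: n => [|n]; [rewrite /= W0K|]; exact: real_spanZ. Qed.

Lemma sat_limitD f g : W f -> W g -> W (f + g).
Proof.
move=> [m _ Wf] [n _ Wg]; exists (maxn m n) => //; apply: sat_spaceD.
  by move: Wf; apply: sat_space_mono; rewrite leq_maxl.
by move: Wg; apply: sat_space_mono; rewrite leq_maxr.
Qed.

Lemma sat_limitZ a f : a \is Num.real -> W f -> W (a *: f).
Proof. by move=> ra [m _ Wf]; exists m => //; exact: sat_spaceZ. Qed.

Lemma sat_limit0 : W 0.
Proof. by exists 0 => //=; rewrite W0K; exact: span_over0. Qed.

Lemma sat_limitD3 p h k :
  W p -> W0 h -> W0 k -> W (fun x => 'i * D3cubic (p x) (h x) (k x)).
Proof.
move=> [n _ Wp] Wh Wk; exists n.+1 => //; apply: sub_real_span; right.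
by exists p, h, k.
Qed.

Lemma W0_mode k : K k -> W0 (mode k).
Proof. by move=> Kk; rewrite W0K; apply: sub_real_span; exists k => //; left. Qed.

Lemma W0_imode k : K k -> W0 ('i *: mode k).
Proof. by move=> Kk; rewrite W0K; apply: sub_real_span; exists k => //; right. Qed.

(** Both phases travel together: [polarization] consumes [p] and ['i *: p] and returns ['i] times
    the product, so each phase of the new mode comes from the other phase of the old one. *)
Lemma sat_limit_step l k k' : W (mode l) -> W ('i *: mode l) -> K k -> K k' ->
  W (mode (l + (k - k'))) /\ W ('i *: mode (l + (k - k'))).
Proof.
move=> Wl Wil Kk Kk'.
have ii : 'i * 'i = -1 :> C by rewrite -expr2 sqrCi.
have ic : 'i^*%R = - 'i :> C by rewrite conjCi.
have cM (a b : C) : (a * b)^*%R = a^*%R * b^*%R by rewrite rmorphM.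
have n0 : (8 : C) != 0 by rewrite pnatr_eq0.
have r8 (e : C) : e \is Num.real -> e / 8 \is Num.real.
  by move=> re; rewrite realM // realV ?realn.
have key p : W p -> W ('i *: p) ->
    W ('i *: (p * mode (k - k'))).
  move=> Wp Wip; have Wk := W0_mode Kk; have Wk' := W0_mode Kk'.
  have Wik := W0_imode Kk; have Wik' := W0_imode Kk'.
  rewrite [X in W X](_ : _ =
     (1 / 8) *: (fun x => 'i * D3cubic (p x) (mode k x) (mode k' x))
   + (1 / 8) *: (fun x => 'i * D3cubic (p x) (('i *: mode k) x) (('i *: mode k') x))
   + ((-1) / 8) *:
       (fun x => 'i * D3cubic (('i *: p) x) (('i *: mode k) x) (mode k' x))
   + (1 / 8) *:
       (fun x => 'i * D3cubic (('i *: p) x) (mode k x) (('i *: mode k') x))).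
    have r1 : (1 : C) \is Num.real by exact: real1.
    have rN1 : (-1 : C) \is Num.real by rewrite realN.
    by repeat apply: sat_limitD; apply: sat_limitZ; (try by apply: r8);
      apply: sat_limitD3.
  apply/funext => x.
  have sE a (f : pt -> C) : (a *: f) x = a * f x by [].
  have aE (f g : pt -> C) : (f + g) x = f x + g x by [].
  have mE (f g : pt -> C) : (f * g) x = f x * g x by [].
  (* Once conjugation is pushed to the factors, the conjugates play the role of the free primed
     variables of [polarization]. *)
  rewrite !(sE, aE, mE) modeD modeN /D3cubic !(cM, ic).
  exact: polarization.
split; last first.
  have := key _ Wl Wil; congr (W ('i *: _)).
  by apply/funext => x; rewrite /= modeD.
(* With [p = 'i *: mode l], [key] gives minus the wanted mode, and the sign is a real scalar. *)
have Wiil : W ('i *: ('i *: mode l)).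
  by rewrite scalerA ii; apply: sat_limitZ => //; rewrite realN real1.
have := sat_limitZ (_ : -1 \is Num.real) (key _ Wil Wiil).
rewrite realN real1 => /(_ isT); congr W; apply/funext => x.
have sE a (f : pt -> C) : (a *: f) x = a * f x by [].
have mE (f g : pt -> C) : (f * g) x = f x * g x by [].
by rewrite !(sE, mE) !modeD !mulrA -(mulrA (-1) 'i 'i) ii mulrNN !mul1r.
Qed.

Lemma mode_sat_limit l : coset K k0 l ->
  W (mode l) /\ W ('i *: mode l).
Proof.
move=> [d Ld <-]; pose P m := W (mode (k0 + m)) /\ W ('i *: mode (k0 + m)).
move: d Ld; apply: (@Lambda_ind K P) => [|m k k' [Wm Wim] Kk Kk'].
  rewrite /P addr0; split; exists 0 => //; first exact: W0_mode.
  exact: W0_imode.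
by rewrite /P addrA; exact: sat_limit_step.
Qed.

Lemma trigD f g : trig f -> trig g -> trig (f + g).
Proof. exact: span_overD. Qed.

Lemma trigZ a f : trig f -> trig (a *: f).
Proof. exact: span_overZ. Qed.

Lemma trig_mode l : coset K k0 l -> trig (mode l).
Proof. by move=> Ll; apply: span_over_subset => //; exists l. Qed.

(** [W] is closed under real scalars only; a complex coefficient splits into real and imaginary
    parts, carried by the two phases of the mode. *)
Lemma trig_sub_sat_limit : trig `<=` W.
Proof.
apply: span_over_ind => [||a f _ [l /mode_sat_limit[Wl Wil] <-]].
- exact: sat_limit0.
- exact: sat_limitD.
rewrite [a]Crect scalerDl; apply: sat_limitD; first exact: sat_limitZ.
by rewrite mulrC -scalerA; exact: sat_limitZ.
Qed.

Lemma real_span_sub_trig (A : set (pt -> C)) :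
  A `<=` trig -> real_span A `<=` trig.
Proof.
move=> At; apply: span_over_ind => [||a f _ /At Tf].
- exact: span_over0.
- exact: trigD.
exact: trigZ.
Qed.

Lemma W0_sub_trig : W0 `<=` trig.
Proof.
rewrite W0K; apply: real_span_sub_trig => f [k Kk [->|->]].
  exact/trig_mode/coset_mem.
exact/trigZ/trig_mode/coset_mem.
Qed.

(** By linearity in [f] and [g] and conjugate linearity in [h], modes suffice. There the exponent is
    [l + d - c], whose signs add up to one, so it stays in the coset. *)
Lemma trig_triple f g h : trig f -> trig g -> trig h ->
  trig (fun x => f x * g x * (h x)^*%R).
Proof.
(* Closure is restated pointwise, because the functions below are abstractions and not literal sums
   or multiples. *)
have T0 (u : pt -> C) : (forall x, u x = 0) -> trig u.
  by move=> u0; rewrite (_ : u = 0); [exact: span_over0|exact/funext].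
have TD (u v w : pt -> C) : trig u -> trig v ->
    (forall x, w x = u x + v x) -> trig w.
  by move=> Tu Tv E; rewrite (_ : w = u + v); [exact: trigD|exact/funext].
have TZ a (u w : pt -> C) : trig u -> (forall x, w x = a * u x) -> trig w.
  by move=> Tu E; rewrite (_ : w = a *: u); [exact: trigZ|exact/funext].
move=> Tf Tg; move: h; apply: span_over_ind => [|u v Tu Tv|a _ _ [c Lc <-]].
- by apply: T0 => x; rewrite rmorph0 mulr0.
- by apply: TD Tu Tv _ => x; rewrite rmorphD /= mulrDr.
apply: (TZ a^*%R (fun x => f x * g x * (mode c x)^*%R)) => [|x]; last first.
  by rewrite rmorphM /= mulrCA.
move: g Tg; apply: span_over_ind => [|u v Tu Tv|b _ _ [d Ld <-]].
- by apply: T0 => x; rewrite mulr0 mul0r.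
- by apply: TD Tu Tv _ => x; rewrite mulrDr mulrDl.
apply: (TZ b (fun x => f x * mode d x * (mode c x)^*%R)) => [|x]; last first.
  by rewrite !mulrA [f x * b]mulrC.
move: f Tf; apply: span_over_ind => [|u v Tu Tv|e _ _ [l Ll <-]].
- by apply: T0 => x; rewrite !mul0r.
- by apply: TD Tu Tv _ => x; rewrite !mulrDl.
apply: (TZ e (mode (l + (d - c)))) => [|x].
  apply: trig_mode; apply: cosetD => //.
  rewrite (_ : d - c = (d - k0) - (c - k0)); last by rewrite opprB addrA subrK.
  by apply: LambdaD; [|apply: LambdaN]; apply/coset_subP.
by rewrite !modeD modeN !mulrA.
Qed.

Lemma sat_limit_trig : W = trig.
Proof.
apply/seteqP; split; last exact: trig_sub_sat_limit.
move=> f [n _]; elim: n f => [|n IH]; first exact: W0_sub_trig.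
apply: real_span_sub_trig => _ [/IH //|[p [h [k [/IH Tp [Wh [Wk ->]]]]]]].
have Th := W0_sub_trig Wh; have Tk := W0_sub_trig Wk.
(* The three summands of [D3cubic] differ in which argument is conjugated. *)
have T := trigZ ('i * 2) (trigD (trigD (trig_triple Tp Th Tk)
  (trig_triple Tp Tk Th)) (trig_triple Th Tk Tp)).
move: T; congr complex_span; apply/funext => x; exact/esym/mulrA.
Qed.

End Saturation.

Lemma common_phase0 (R : realType) (K : set 'rV[int]_3) (x : 'rV[R]_3) c :
  K 0 -> common_phase K x c -> c = 1.
Proof. by move=> K0 [_ [_ /(_ 0 K0)]]; rewrite mode0. Qed.

(** * Iterated integrals over the fundamental cell *)

Section CoordinateIntegral.
Variable R : realType.
Local Notation mu := (@lebesgue_measure R).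
Local Notation pt := 'rV[R]_3.
Local Notation cell := (`[0, 2 * pi]%classic : set R).

Definition subst_coord (i : 'I_3) (z : R) (x : pt) : pt :=
  x + (z - x 0 i) *: delta_mx 0 i.

(** The result is kept as a function on all of [pt], constant in coordinate [i], so that the triple
    integral is a composition of three operators of one type. *)
Definition coord_int (i : 'I_3) (g : pt -> R) : pt -> R :=
  fun x => \int[mu]_(z in cell) g (subst_coord i z x).

Lemma subst_coordE i z x j :
  subst_coord i z x 0 j = if j == i then z else x 0 j.
Proof.
rewrite !mxE eqxx /=; case: eqP => [->|_]; first by rewrite mulr1 addrC subrK.
by rewrite mulr0 addr0.
Qed.

Lemma continuous_subst_coord i :
  continuous (fun p : pt * R => subst_coord i p.2 p.1).
Proof.
move=> p; apply: cvgD; first exact: cvg_fst.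
apply: cvgZr_tmp; apply: cvgB; first exact: cvg_snd.
apply: (@cvg_comp _ _ _ fst (fun x : pt => x 0 i)); first exact: cvg_fst.
exact: coord_continuous.
Qed.

Lemma two_pi_gt0 : 0 < 2 * pi :> R.
Proof. by rewrite mulr_gt0 ?pi_gt0. Qed.

Lemma cell_measure : fine (mu cell) = 2 * pi.
Proof. by rewrite lebesgue_measure_itv /= lte_fin two_pi_gt0 sube0. Qed.

Lemma cell_integrable (g : R -> R) :
  continuous g -> mu.-integrable cell (EFin \o g).
Proof.
move=> cg; apply: continuous_compact_integrable; first exact: segment_compact.
exact: continuous_subspaceT.
Qed.

Lemma cell_int_bound (g : R -> R) (M : R) : continuous g ->
    (forall z, cell z -> `|g z| <= M) ->
  `|\int[mu]_(z in cell) g z| <= M * (2 * pi).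
Proof.
move=> cg gM; apply: le_trans (le_normr_Rintegral _ _) _ => //.
  exact: cell_integrable.
rewrite -[X in _ <= _ * X]cell_measure -Rintegral_cst //.
apply: le_Rintegral => //.
  by apply: cell_integrable => x; apply: cvg_norm; exact: cg.
by apply: cell_integrable => x; exact: cvg_cst.
Qed.

Lemma continuous_slice i (g : pt -> R) x :
  continuous g -> continuous (fun z : R => g (subst_coord i z x)).
Proof.
move=> cg z.
apply: (@cvg_comp _ _ _ (fun z : R => subst_coord i z x) g); last exact: cg.
apply: cvgD; first exact: cvg_cst.
by apply: cvgZr_tmp; apply: cvgB; [exact: cvg_id|exact: cvg_cst].
Qed.

(** Compactness of the cell makes the continuity of [g] in [x] uniform in the integrated
    variable. *)
Lemma continuous_coord_int i (g : pt -> R) :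
  continuous g -> continuous (coord_int i g).
Proof.
move=> cg x; apply/(@cvgrPdist_le _ _ _ _ (nbhs_filter x)) => e e0.
have nc := (compact_near_coveringP cell).1 (@segment_compact R 0 (2 * pi)).
have slice y := @continuous_slice i g y cg.
(* Each [z] has a product neighbourhood on which the variation is small; the near-covering form of
   compactness extracts one neighbourhood of [x]. The bound [e / (2 * pi)] becomes [e] over a cell
   of length [2 * pi]. *)
have near_le : \forall y \near x, cell `<=`
    (fun z => `|g (subst_coord i z x) - g (subst_coord i z y)| <= e / (2 * pi)).
  apply: (nc _ (nbhs x) _ (nbhs_filter x)) => z _.
  have cF : (fun p : pt * R => g (subst_coord i p.2 x) - g (subst_coord i p.2 p.1))
      p @[p --> (x, z)] --> g (subst_coord i z x) - g (subst_coord i z x).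
    apply: cvgB.
      apply: (@cvg_comp _ _ _ snd (fun z : R => g (subst_coord i z x))).
        exact: cvg_snd.
      exact: slice.
    apply: (@cvg_comp _ _ _ (fun p : pt * R => subst_coord i p.2 p.1) g).
      exact: (@continuous_subst_coord i (x, z)).
    exact: cg.
  rewrite subrr in cF.
  move/cvgr0Pnorm_le: cF => /(_ (e / (2 * pi))) /=.
  rewrite divr_gt0 ?two_pi_gt0// => /(_ isT) [[A B] /= [Ax Bz] AB].
  exists (B, A) => //= -[z' y] /= [Bz' Ay].
  exact: (AB (y, z')).
near=> y.
rewrite /coord_int -RintegralB //; try exact: cell_integrable.
rewrite -[e](@divfK _ (2 * pi)) ?gt_eqF ?two_pi_gt0 //.
apply: cell_int_bound.
  by move=> z; apply: cvgB; exact: slice.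
by near: y.
Unshelve. all: by end_near. Qed.

Lemma coord_int_lin i a b (g h : pt -> R) : continuous g -> continuous h ->
  coord_int i (fun x => a * g x + b * h x) =
    (fun x => a * coord_int i g x + b * coord_int i h x).
Proof.
move=> cg ch; apply/funext => x; rewrite /coord_int.
have s (f : pt -> R) c : continuous f ->
    continuous (fun z : R => c * f (subst_coord i z x)).
  by move=> cf z; apply: cvgM; [exact: cvg_cst|exact: continuous_slice].
rewrite RintegralD //; try by apply: cell_integrable; exact: s.
by rewrite !RintegralZl //; apply: cell_integrable; exact: continuous_slice.
Qed.

Lemma coord_int_bound i (g : pt -> R) M : continuous g -> (forall x, `|g x| <= M) ->
  forall x, `|coord_int i g x| <= M * (2 * pi).
Proof. by move=> cg gM x; apply: cell_int_bound => //; exact: continuous_slice. Qed.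

(** The base point 0 is immaterial, as all three coordinates get overwritten. *)
Lemma torus_RintE (g : pt -> R) :
  torus_Rint g = coord_int 0 (coord_int 1 (coord_int 2 g)) 0.
Proof.
rewrite /torus_Rint /coord_int.
apply: eq_Rintegral => x _; apply: eq_Rintegral => y _; apply: eq_Rintegral => z _.
congr g; apply/rowP => j; rewrite !subst_coordE !mxE.
by case: j => -[|[|[|]]].
Qed.

Lemma torus_Rint_lin a b (g h : pt -> R) : continuous g -> continuous h ->
  torus_Rint (fun x => a * g x + b * h x) = a * torus_Rint g + b * torus_Rint h.
Proof.
by move=> cg ch; rewrite !torus_RintE !coord_int_lin //;
  do ?apply: continuous_coord_int.
Qed.

Lemma torus_Rint_bound (g : pt -> R) M :
  continuous g -> (forall x, `|g x| <= M) -> `|torus_Rint g| <= M * (2 * pi) ^+ 3.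
Proof.
move=> cg gM; rewrite torus_RintE.
rewrite (_ : M * (2 * pi) ^+ 3 = M * (2 * pi) * (2 * pi) * (2 * pi)); last by ring.
have c2 := @continuous_coord_int 2 _ cg; have c1 := @continuous_coord_int 1 _ c2.
exact: (coord_int_bound _ c1 (coord_int_bound _ c2 (coord_int_bound _ cg gM))).
Qed.

Lemma dot_subst_coord k i z (x : pt) :
  dot k (subst_coord i z x) = (k 0 i)%:~R * z + dot k (subst_coord i 0 x).
Proof.
rewrite /dot (bigD1 i) //= [in RHS](bigD1 i) //= !subst_coordE eqxx mulr0 add0r.
by congr +%R; apply: eq_bigr => j /negbTE ji; rewrite !subst_coordE ji.
Qed.

Lemma expi_2pi_int (k : int) : expi (2 * pi * k%:~R : R) = 1.
Proof.
have e1 : expi (2 * pi : R) = 1 by rewrite /expi mulrC mulr_natr cos2pi sin2pi.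
have en (n : nat) : expi (2 * pi * n%:~R : R) = 1.
  elim: n => [|n IH]; first by rewrite mulr0 expi0.
  by rewrite intS intrD mulrDr expiD IH mulr1 mulr1z mulr1 e1.
by case: k => n //; rewrite NegzE rmorphN mulrN expiN en rmorph1.
Qed.

Lemma cell_int_cos (k : int) (A : R) : k != 0 ->
  \int[mu]_(z in cell) cos (k%:~R * z + A) = 0.
Proof.
move=> k0; have kR : k%:~R != 0 :> R by rewrite intr_eq0.
(* A primitive of the integrand; its values at the two ends agree because [k] is an integer. *)
pose F z := k%:~R^-1 * sin (k%:~R * z + A).
have dF (z : R) : is_derive z (1 : R) (F : R -> R) (cos (k%:~R * z + A)).
  rewrite (_ : F = (k%:~R^-1 : R) *: (sin \o (fun y : R => k%:~R * y + A))) //.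
  have dl : is_derive z (1 : R) (fun y : R => k%:~R * y + A) (k%:~R).
    rewrite (_ : (fun _ => _) = (k%:~R : R) *: (id : R -> R) + cst A) //.
    by apply: is_derive_eq; rewrite addr0 /GRing.scale /= mulr1.
  apply: is_derive_eq; rewrite /GRing.scale /=.
  by field.
have cF : continuous F.
  by move=> z; apply: differentiable_continuous; apply/derivable1_diffP.
rewrite /Rintegral (@continuous_FTC2 _ _ F) ?two_pi_gt0 //=.
- rewrite /F mulr0 add0r.
  have := expi_2pi_int k; rewrite /expi => -[]; rewrite mulrC => c1 s0.
  by rewrite sinD c1 s0 mul0r mul1r add0r subrr.
- apply: continuous_subspaceT => z.
  apply: (@continuous_comp _ _ _ (fun y : R => k%:~R * y + A) cos).
    apply: cvgD; last exact: cvg_cst.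
    by apply: cvgM; [exact: cvg_cst|exact: cvg_id].
  exact: continuous_cos.
- split=> [z _||]; first exact: ex_derive.
    by apply: cvg_at_right_filter; exact: cF.
  by apply: cvg_at_left_filter; exact: cF.
by move=> z _; rewrite derive1E derive_val.
Qed.

Lemma continuous_mulf (f g : pt -> R) :
  continuous f -> continuous g -> continuous (fun x => f x * g x).
Proof. by move=> cf cg x; exact: (continuousM (cf x) (cg x)). Qed.

Lemma continuous_addf (f g : pt -> R) :
  continuous f -> continuous g -> continuous (fun x => f x + g x).
Proof. by move=> cf cg x; exact: (continuousD (cf x) (cg x)). Qed.

Lemma continuous_subf (f g : pt -> R) :
  continuous f -> continuous g -> continuous (fun x => f x - g x).
Proof. by move=> cf cg x; exact: (continuousB (cf x) (cg x)). Qed.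

Lemma continuous_wave k (c : R) : continuous (fun x : pt => cos (dot k x + c)).
Proof.
have [cr _] := mode_smooth_Re R k nil.
have [ci _] := mode_smooth_Im R k nil.
rewrite (_ : (fun _ => _) =
  fun x : pt => cos (dot k x) * cos c - sin (dot k x) * sin c).
  by apply: continuous_subf; apply: continuous_mulf => //; exact: cst_continuous.
by apply/funext => x; rewrite cosD.
Qed.

(** Waves are eigenfunctions of each coordinate integral, so the triple integral is a product of
    three eigenvalues. The phase [c] lets cosine and sine be treated at once. *)
Lemma coord_int_wave i k (c : R) :
  coord_int i (fun x => cos (dot k x + c)) =
    (fun x => (if k 0 i == 0 then 2 * pi else 0) * cos (dot k x + c)).
Proof.
apply/funext => x; rewrite /coord_int.
case: ifPn => [/eqP ki|ki]; last first.
  rewrite mul0r -[RHS](cell_int_cos (dot k (subst_coord i 0 x) + c) ki).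
  by apply: eq_Rintegral => z _; rewrite dot_subst_coord addrA.
have E z : dot k (subst_coord i z x) = dot k (subst_coord i 0 x).
  by rewrite dot_subst_coord ki mul0r add0r.
(* The point [x] is its own substitution, with value [x 0 i]. *)
have D z : dot k (subst_coord i z x) = dot k x.
  by rewrite E -(E (x 0 i)) /subst_coord subrr scale0r addr0.
under eq_Rintegral do rewrite D.
by rewrite Rintegral_cst // cell_measure mulrC.
Qed.

Lemma torus_Rint_wave k (c : R) :
  torus_Rint (fun x => cos (dot k x + c)) =
    if k == 0 then (2 * pi) ^+ 3 * cos c else 0.
Proof.
have Z i a : coord_int i (fun x => a * cos (dot k x + c)) =
    (fun x => a * (if k 0 i == 0 then 2 * pi else 0) * cos (dot k x + c)).
  have cw := @continuous_wave k c.
  have := coord_int_lin i a 0 cw cw.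
  rewrite (_ : (fun x => a * _ + _) = (fun x => a * cos (dot k x + c))); last first.
    by apply/funext => x; rewrite mul0r addr0.
  by move=> ->; apply/funext => x; rewrite coord_int_wave mul0r addr0 mulrA.
rewrite torus_RintE coord_int_wave !Z.
case: (k =P 0) => [->|k0]; first by rewrite !mxE eqxx dot0 add0r; ring.
have [i ki] : exists i, k 0 i != 0.
  apply: contra_notP k0 => /forallNP k0; apply/rowP => i; rewrite mxE.
  by apply/eqP; move: (k0 i) => /negP; rewrite negbK.
have I3 (j : 'I_3) : [|| j == 0, j == 1 | j == 2] by case: j => -[|[|[|]]].
by case/or3P: (I3 i) ki => /eqP -> /negbTE ->; rewrite ?(mul0r, mulr0).
Qed.

(** * Complex integrals and Fourier coefficients *)

(** Stated on real and imaginary parts because [torus_int] integrates these separately. *)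
Definition ccontinuous (f : pt -> R[i]) :=
  continuous (fun x => complex.Re (f x)) /\ continuous (fun x => complex.Im (f x)).

Lemma ccontinuousM f g :
  ccontinuous f -> ccontinuous g -> ccontinuous (fun x => f x * g x).
Proof.
move=> [fr fi] [gr gi]; split.
  rewrite (_ : (fun _ => _) = (fun x => complex.Re (f x) * complex.Re (g x)
      - complex.Im (f x) * complex.Im (g x))); last first.
    by apply/funext => y; case: (f y) (g y) => [? ?] [].
  by apply: continuous_subf; exact: continuous_mulf.
rewrite (_ : (fun _ => _) = (fun x => complex.Re (f x) * complex.Im (g x)
    + complex.Im (f x) * complex.Re (g x))); last first.
  by apply/funext => y; case: (f y) (g y) => [? ?] [].
by apply: continuous_addf; exact: continuous_mulf.
Qed.

Lemma ccontinuous_mode k : ccontinuous (mode k).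
Proof.
by split; [case: (mode_smooth_Re R k nil)|case: (mode_smooth_Im R k nil)].
Qed.

Lemma ccontinuous_test (f : test_fun R) : ccontinuous f.
Proof. by split; [case: (test_smooth_Re f nil)|case: (test_smooth_Im f nil)]. Qed.

Lemma torus_int_eq (f : pt -> R[i]) (u v : pt -> R) :
    (fun x => complex.Re (f x)) = u -> (fun x => complex.Im (f x)) = v ->
  torus_int f = torus_Rint u +i* torus_Rint v.
Proof. by move=> <- <-. Qed.

Lemma torus_int_lin a b f g : ccontinuous f -> ccontinuous g ->
  torus_int (fun x => a * f x + b * g x) = a * torus_int f + b * torus_int g.
Proof.
move=> [fr fi] [gr gi].
have cl u v (h k : pt -> R) : continuous h -> continuous k ->
    continuous (fun x => u * h x + v * k x).
  by move=> ch ck; apply: continuous_addf; apply: continuous_mulf => //;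
    exact: cst_continuous.
case: a b => [a a'] [b b'].
(* The factors [1] give the real and imaginary parts the shape required by [torus_Rint_lin]. *)
have -> : torus_int (fun x => (a +i* a') * f x + (b +i* b') * g x) =
  torus_Rint (fun x => 1 * (a * complex.Re (f x) + - a' * complex.Im (f x))
    + 1 * (b * complex.Re (g x) + - b' * complex.Im (g x)))
  +i* torus_Rint (fun x => 1 * (a * complex.Im (f x) + a' * complex.Re (f x))
    + 1 * (b * complex.Im (g x) + b' * complex.Re (g x))).
  apply: torus_int_eq; apply/funext => y;
    by case: (f y) (g y) => [? ?] [? ?] /=; ring.
rewrite !torus_Rint_lin //; try exact: cl.
rewrite /torus_int.
move: (torus_Rint _) (torus_Rint _) (torus_Rint _) (torus_Rint _) => p q r t.
by simpc; apply/eqP; rewrite eq_complex /=; apply/andP; split; apply/eqP; ring.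
Qed.

Lemma torus_int_mode k :
  torus_int (mode k : pt -> R[i]) = if k == 0 then ((2 * pi) ^+ 3)%:C else 0.
Proof.
(* The sine is a cosine shifted by a quarter period, so [torus_Rint_wave] covers both parts. *)
have -> : torus_int (mode k : pt -> R[i]) =
    torus_Rint (fun x : pt => cos (dot k x + 0)) +i*
    torus_Rint (fun x : pt => cos (dot k x + - (pi / 2))).
  apply: torus_int_eq; apply/funext => x; rewrite /= ?addr0 //.
  by rewrite cosB cos_pihalf sin_pihalf mulr0 add0r mulr1.
rewrite !torus_Rint_wave cosN cos_pihalf cos0 mulr1 mulr0.
by case: eqP.
Qed.

Lemma normc_le_ReIm (a b M : R) :
  `|a| <= M -> `|b| <= M -> `|a +i* b| <= (2 * M)%:C.
Proof.
move=> aM bM; rewrite normc_def lecR /=.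
have M0 : 0 <= 2 * M by rewrite mulr_ge0 // (le_trans _ aM).
rewrite -[2 * M]ger0_norm // -sqrtr_sqr ler_wsqrtr //.
have sq c : `|c| <= M -> c ^+ 2 <= M ^+ 2.
  by move=> cM; rewrite -real_normK ?num_real // lerXn2r // nnegrE (le_trans _ cM).
have := sq a aM; have := sq b bM; have := sqr_ge0 M; nra.
Qed.

Lemma torus_int_bound f M : ccontinuous f ->
  (forall x, `|f x| <= M%:C) -> `|torus_int f| <= (2 * (2 * pi) ^+ 3 * M)%:C.
Proof.
move=> [fr fi] fM; rewrite -mulrA [(_ ^+ 3) * _]mulrC.
apply: normc_le_ReIm; apply: torus_Rint_bound => // x; rewrite -lecR.
  exact: le_trans (normc_ge_Re _) (fM x).
apply: le_trans (fM x); rewrite normc_def lecR.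
by rewrite -sqrtr_sqr ler_wsqrtr // lerDr sqr_ge0.
Qed.

Lemma ccontinuous_lin a b f g : ccontinuous f -> ccontinuous g ->
  ccontinuous (fun x => a * f x + b * g x).
Proof.
have cC c : ccontinuous (fun=> c) by split; exact: cst_continuous.
move=> cf cg; have [fr fi] := ccontinuousM (cC a) cf.
have [gr gi] := ccontinuousM (cC b) cg.
split.
  rewrite (_ : (fun _ => _) = fun x =>
    complex.Re (a * f x) + complex.Re (b * g x)); first exact: continuous_addf.
  by apply/funext => x; case: (a * f x) (b * g x) => [? ?] [].
rewrite (_ : (fun _ => _) = fun x =>
  complex.Im (a * f x) + complex.Im (b * g x)); first exact: continuous_addf.
by apply/funext => x; case: (a * f x) (b * g x) => [? ?] [].
Qed.

Lemma fourier_regular_lin a b f g l : ccontinuous f -> ccontinuous g ->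
  fourier (regular (fun x => a * f x + b * g x)) l =
    a * fourier (regular f) l + b * fourier (regular g) l.
Proof.
move=> cf cg; rewrite /fourier /regular.
rewrite [X in _ * X = _](_ : _ = torus_int (fun x =>
    a * (f x * mode (- l) x) + b * (g x * mode (- l) x))); last first.
  by congr torus_int; apply/funext => x /=; rewrite mulrDl !mulrA.
have cfm := ccontinuousM cf (ccontinuous_mode (- l)).
have cgm := ccontinuousM cg (ccontinuous_mode (- l)).
rewrite (torus_int_lin a b cfm cgm) mulrDr.
by congr (_ + _); rewrite mulrCA.
Qed.

Lemma fourier_regular_mode k l :
  fourier (regular (mode k : pt -> R[i])) l = (k == l)%:R.
Proof.
rewrite /fourier /regular.
rewrite [X in _ * X = _](_ : _ = torus_int (mode (k - l) : pt -> R[i])); last first.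
  by congr torus_int; apply/funext => x /=; rewrite modeD.
rewrite torus_int_mode subr_eq0; case: eqP => _; last by rewrite mulr0.
by rewrite -rmorphM /= mulVf ?rmorph1 // expf_neq0 // gt_eqF // two_pi_gt0.
Qed.

Lemma regular_mode_distribution k :
  torus_distribution (regular (mode k : pt -> R[i])).
Proof.
split=> [a b f g h hE|].
  rewrite /regular.
  rewrite [LHS](_ : _ = torus_int (fun x =>
      a * (mode k x * f x) + b * (mode k x * g x))); last first.
    by congr torus_int; apply/funext => x; rewrite hE mulrDr !(mulrCA (mode k x)).
  exact: (torus_int_lin a b
    (ccontinuousM (ccontinuous_mode k) (ccontinuous_test f))
    (ccontinuousM (ccontinuous_mode k) (ccontinuous_test g))).
(* Order 0 suffices: a mode has modulus 1, so the constant is that of [torus_int_bound]. *)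
exists (2 * (2 * pi) ^+ 3), 0%N => f M fM; apply: torus_int_bound.
  by apply: ccontinuousM; [exact: ccontinuous_mode|exact: ccontinuous_test].
move=> x; rewrite normrM (_ : `|mode k x| = 1) ?mul1r; last first.
  by rewrite /mode normc_def /= cos2Dsin2 sqrtr1.
have := fM [::] x isT; rewrite /cpartials /partials /=.
by case: (f x).
Qed.

End CoordinateIntegral.

(** * Closures in Sobolev spaces *)

Section SobolevClosure.
Variable R : realType.
Local Notation C := R[i].
Local Notation pt := 'rV[R]_3.
Implicit Types (s : R) (u : test_fun R -> C) (l : 'rV[int]_3).

Definition sobolev_term s u l : R :=
  (1 + \sum_(i < 3) (l 0 i)%:~R ^+ 2) `^ s
    * (complex.Re (fourier u l) ^+ 2 + complex.Im (fourier u l) ^+ 2).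

(** The square of [sobolev_norm]; unlike the norm, it is additive over disjoint sets of
    frequencies. *)
Definition sobolev_sum s u : \bar R :=
  \esum_(l in [set: 'rV[int]_3]) (sobolev_term s u l)%:E.

Lemma sobolev_weight_gt0 s l :
  0 < (1 + \sum_(i < 3) (l 0 i)%:~R ^+ 2) `^ s :> R.
Proof.
by rewrite powR_gt0 // ltr_pwDl // sumr_ge0 // => i _; exact: sqr_ge0.
Qed.

Lemma sobolev_term_ge0 s u l : 0 <= sobolev_term s u l.
Proof. by rewrite mulr_ge0 ?addr_ge0 ?sqr_ge0 // ltW ?sobolev_weight_gt0. Qed.

Lemma sobolev_term_eq0 s u l : sobolev_term s u l = 0 <-> fourier u l = 0.
Proof.
rewrite /sobolev_term; split=> [/eqP|->]; last by rewrite /= expr0n addr0 mulr0.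
rewrite mulf_eq0 gt_eqF ?sobolev_weight_gt0 //= paddr_eq0 ?sqr_ge0 //.
by rewrite !sqrf_eq0 -(eq_complex (fourier u l) 0) => /eqP.
Qed.

Lemma sobolev_term_le_sum s u l : ((sobolev_term s u l)%:E <= sobolev_sum s u)%E.
Proof.
apply: esum_ge; exists [set l]; first by split => //; exact: finite_set1.
by rewrite fsbig_set1.
Qed.

Lemma sobolev_sum_ge0 s u : (0 <= sobolev_sum s u)%E.
Proof. by apply: esum_ge0 => l _; rewrite lee_fin sobolev_term_ge0. Qed.

Lemma sobolev_normE s u : sobolev_norm s u = sqrte (sobolev_sum s u).
Proof. exact/poweR12_sqrt/sobolev_sum_ge0. Qed.

Lemma sobolev_norm_lt s u (e : R) : 0 < e ->
  (sobolev_norm s u < e%:E)%E <-> (sobolev_sum s u < (e ^+ 2)%:E)%E.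
Proof.
move=> e0; rewrite sobolev_normE; have := sobolev_sum_ge0 s u.
case: (sobolev_sum s u) => [r r0|_|] //=.
have ee : Num.sqrt (e ^+ 2) = e by rewrite sqrtr_sqr gtr0_norm.
by rewrite !lte_fin -{1}ee ltr_sqrt ?exprn_gt0.
Qed.

Lemma sobolev_norm_lty s u :
  (sobolev_norm s u < +oo)%E <-> (sobolev_sum s u < +oo)%E.
Proof.
rewrite sobolev_normE; have := sobolev_sum_ge0 s u.
by case: (sobolev_sum s u) => [r _|_|] //=; rewrite !ltry.
Qed.

Variable A : set 'rV[int]_3.
Local Notation trig := (complex_span [set (mode l : pt -> C) | l in A]).

Lemma fourier_regular0 l : fourier (regular (0 : pt -> C)) l = 0.
Proof.
have c0 : ccontinuous (0 : pt -> C) by split; exact: cst_continuous.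
have := fourier_regular_lin 0 0 l c0 c0.
rewrite !mul0r addr0 => E; rewrite -[RHS]E.
by congr (fourier (regular _) l); apply/funext => x; rewrite !mul0r addr0.
Qed.

(** Continuity is carried through the induction because the linearity of Fourier coefficients of
    regular distributions relies on it. *)
Lemma trig_fourier w : trig w ->
  ccontinuous w /\ forall l, ~ A l -> fourier (regular w) l = 0.
Proof.
have c0 : ccontinuous (0 : pt -> C) by split; exact: cst_continuous.
move: w; apply: span_over_ind => [|f g [cf f0] [cg g0]|a f _ [k Ak <-]].
- by split=> [//|l _]; exact: fourier_regular0.
- have E : f + g = (fun x => 1 * f x + 1 * g x).
    by apply/funext => x; rewrite !mul1r.
  rewrite E; split=> [|l Al]; first exact: ccontinuous_lin.
  apply: (eq_trans (fourier_regular_lin 1 1 l cf cg)).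
  apply: (eq_trans (congr2 (fun p q => 1 * p + 1 * q) (f0 l Al) (g0 l Al))).
  by rewrite !mulr0 addr0.
have E : a *: (mode k : pt -> C) = (fun x => a * mode k x + 0 * mode k x).
  by apply/funext => x; rewrite mul0r addr0.
have cm := @ccontinuous_mode R k.
rewrite E; split=> [|l Al]; first exact: ccontinuous_lin.
apply: (eq_trans (fourier_regular_lin a 0 l cm cm)).
rewrite mul0r addr0 fourier_regular_mode.
by case: eqP => [kl|_]; [case: Al; rewrite -kl|rewrite mulr0].
Qed.

(** The witness is the partial Fourier sum over [X]. Frequencies of [X] outside [A] do no harm,
    since their coefficients vanish. *)
Lemma trig_interpolation u (X : set 'rV[int]_3) :
    finite_set X -> (forall l, ~ A l -> fourier u l = 0) ->
  exists2 w, trig w & forall l,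
    fourier (regular w) l = if l \in X then fourier u l else 0.
Proof.
move=> /finite_seqP[r Xr] uA.
(* An enumeration of [X] with repetitions would count a coefficient several times. *)
have rX l : (l \in X) = (l \in undup r).
  by rewrite mem_undup; apply/idP/idP; rewrite Xr inE.
pose w (t : seq 'rV[int]_3) : pt -> C :=
  \sum_(l <- t) fourier u l *: (mode l : pt -> C).
have wt t : trig (w t).
  rewrite /w; elim/big_ind : _ => [||l _]; [exact: span_over0|exact: span_overD|].
  have [Al|/uA ->] := pselect (A l); last by rewrite scale0r; exact: span_over0.
  by apply: span_overZ => //; apply: span_over_subset => //; exists l.
exists (w (undup r)) => // l; rewrite rX.
elim: (undup r) (undup_uniq r) => [_|k t IH /= /andP[kt /IH {}IH]].
  by rewrite /w big_nil in_nil; exact: fourier_regular0.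
have -> : w (k :: t) = (fun x => fourier u k * mode k x + 1 * w t x).
  by rewrite /w big_cons; apply/funext => x; rewrite mul1r.
apply: (eq_trans (fourier_regular_lin _ _ _ (@ccontinuous_mode R k)
  (trig_fourier (wt t)).1)).
apply: (eq_trans (congr2 (fun p q => _ * p + 1 * q)
  (fourier_regular_mode R k l) IH)).
rewrite mul1r in_cons [l == k]eq_sym.
by case: eqP kt => [-> /negbTE ->|_ _]; rewrite ?mulr1 ?addr0 ?mulr0 ?add0r.
Qed.

Lemma fourierB u v l :
  fourier (fun f => u f - v f) l = fourier u l - fourier v l.
Proof. by rewrite /fourier mulrBr. Qed.

(** Elements of the span have zero coefficients off [A], so a nonzero term of [u] there bounds its
    squared distance to the span from below. Conversely, partial Fourier sums supported in [A]
    approximate [u]. *)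
Lemma Sobolev_closure_trig s : Sobolev_closure s trig = Sobolev_supported s A.
Proof.
apply/seteqP; split=> u [Su H]; split=> //.
  move=> l Al; apply: contrapT => ul.
  have t0 : 0 < sobolev_term s u l.
    rewrite lt0r sobolev_term_ge0 andbT; apply/eqP => /sobolev_term_eq0; exact: ul.
  (* The radius is chosen so that its square is the term at [l], which the squared distance cannot
     undercut. *)
  have [|w Tw] := H (Num.sqrt (sobolev_term s u l)); first by rewrite sqrtr_gt0.
  rewrite sobolev_norm_lt ?sqrtr_gt0 // sqr_sqrtr ?sobolev_term_ge0 //.
  move=> /(le_lt_trans (sobolev_term_le_sum _ _ l)).
  rewrite lte_fin {1}/sobolev_term fourierB (trig_fourier Tw).2 // subr0.
  by rewrite ltxx.
move=> e e0; have [_ /sobolev_norm_lty Sy] := Su.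
have Sfin : sobolev_sum s u \is a fin_num.
  by rewrite ge0_fin_numE // sobolev_sum_ge0.
have e2 : 0 < e ^+ 2 by rewrite exprn_gt0.
(* The sum is a supremum of finite partial sums; [X] comes within [e ^+ 2] of it. *)
have [_ [X [finX _] <-] SX] := ub_ereal_sup_adherent e2 Sfin.
have [w Tw wE] := trig_interpolation finX H; exists w => //.
rewrite sobolev_norm_lt //.
have term0 (v : test_fun R -> C) l : (0 <= (sobolev_term s v l)%:E)%E.
  by rewrite lee_fin sobolev_term_ge0.
(* Truncation cancels the terms in [X] and leaves the others alone, so the squared distance is the
   tail of the sum for [u]. *)
have -> : sobolev_sum s (fun f => u f - regular w f) =
    \esum_(l in setT `&` ~` X) (sobolev_term s u l)%:E.
  rewrite /sobolev_sum (esumID X) // esum1 ?add0e => [|l [_ Xl]]; last first.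
    congr EFin; apply/sobolev_term_eq0.
    by rewrite fourierB wE mem_set // subrr.
  apply: eq_esum => l [_ Xl]; congr EFin.
  by rewrite /sobolev_term fourierB wE memNset // subr0.
move: SX; rewrite -[ereal_sup _]/(sobolev_sum s u) {1}/sobolev_sum (esumID X) //.
rewrite !setTI esum_fset // lteBlDr //.
have Xfin : \sum_(l \in X) (sobolev_term s u l)%:E \is a fin_num.
  by rewrite fsumEFin.
by rewrite lteD2lE.
Qed.

Lemma Sobolev_mode s l : Sobolev s (regular (mode l : pt -> C)).
Proof.
split; first exact: regular_mode_distribution.
apply/sobolev_norm_lty; rewrite /sobolev_sum (esumID [set l]); last first.
  by move=> k _; rewrite lee_fin sobolev_term_ge0.
rewrite setTI esum_set1 ?lee_fin ?sobolev_term_ge0 //.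
rewrite esum1 ?adde0 ?ltry // => k [_ /= kl]; congr EFin; apply/sobolev_term_eq0.
by rewrite fourier_regular_mode; case: eqP kl => // <-.
Qed.

(** A frequency missing from [A] is detected by its own mode, which lies in every Sobolev space. *)
Lemma Sobolev_supported_all s : Sobolev_supported s A = @Sobolev R s <-> A = setT.
Proof.
split=> [E|->]; last first.
  by apply/seteqP; split=> [u []//|u Su]; split=> // l [].
apply/seteqP; split=> // l _; apply: contrapT => Al.
have : Sobolev_supported s A (regular (mode l : pt -> C)).
  by rewrite E; exact: Sobolev_mode.
move=> [_ /(_ l Al)]; rewrite fourier_regular_mode eqxx.
by move/eqP; rewrite oner_eq0.
Qed.

End SobolevClosure.

(** * The full lattice and common phases *)

Lemma coset_setT (K : set 'rV[int]_3) k0 :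
  coset K k0 = setT <-> Lambda K = setT.
Proof.
split=> E; apply/seteqP; split=> // l _.
  have : coset K k0 (l + k0) by rewrite E.
  by move/coset_subP; rewrite addrK.
by apply/coset_subP; rewrite E.
Qed.

Section CommonPhase.
Variable R : realType.
Local Notation pt := 'rV[R]_3.

(** Modulo [2 * pi] the angle becomes [r] in [0, 2 pi). If [r] were nonzero, its half would have
    positive sine, and the double angle formula would give [cos r < 1]. *)
Lemma expi_eq1 (t : R) : expi t = 1 -> exists m : int, t = 2 * pi * m%:~R.
Proof.
move=> et; have p0 := two_pi_gt0 R.
pose m := Num.floor (t / (2 * pi)); exists m.
pose r := t - 2 * pi * m%:~R.
have er : expi r = 1.
  by rewrite /r expiD expiN expi_2pi_int et rmorph1 mulr1.
have r0 : 0 <= r by rewrite subr_ge0 mulrC -ler_pdivlMr // floor_le.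
have r2 : r < 2 * pi.
  rewrite ltrBlDr -[X in _ < X + _]mulr1 -mulrDr mulrC -ltr_pdivrMr //.
  by rewrite addrC -[1]/(1%:~R) -intrD floorD1_gt.
have [r00|rn0] := eqVneq r 0; first by apply/eqP; rewrite -subr_eq0 -/r r00.
have s0 : 0 < sin (r / 2).
  have rp : 0 < r by rewrite lt0r rn0.
  by apply: sin_gt0_pi; apply/andP; split; lra.
have : cos (r / 2 + r / 2) = 1 by rewrite -splitr; case: er.
rewrite cosD -!expr2; have := cos2Dsin2 (r / 2); move: s0.
by move: (cos (r / 2)) (sin (r / 2)) => u v; nra.
Qed.

Lemma mode_Lambda1 (K : set 'rV[int]_3) (x : pt) (c : R[i]) :
    (forall k, K k -> mode k x = c) ->
  forall l, Lambda K l -> mode l x = 1.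
Proof.
move=> Kc; apply: Lambda_ind => [|l k k' IH Kk Kk']; first exact: mode0.
by rewrite !modeD IH modeN mul1r !Kc // -(Kc k' Kk') mode_conj.
Qed.

Lemma dot_delta i (x : pt) : dot (delta_mx 0 i) x = x 0 i.
Proof.
rewrite /dot (bigD1 i) //= big1 => [|j ji].
  by rewrite !mxE !eqxx /= mul1r addr0.
by rewrite !mxE (negbTE ji) mul0r.
Qed.

(** By [mode_Lambda1] the character given by [x] is trivial on the whole lattice; on the standard
    basis this puts each coordinate of [x] in 2 pi Z. *)
Lemma Lambda_full_no_phase (K : set 'rV[int]_3) :
  Lambda K = setT -> ~ exists (x : pt) c, common_phase K x c.
Proof.
move=> KT [x [c [x0 [_ Kc]]]]; apply: x0.
have xi i : exists m : int, x 0 i = 2 * pi * m%:~R.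
  apply: expi_eq1; rewrite -dot_delta; apply: (mode_Lambda1 Kc).
  by rewrite KT.
have [m mE] := choice xi; exists (\row_i m i).
by apply/rowP => i; rewrite !mxE mE.
Qed.

Lemma dot_period k m : dot k (@period R m) =
  2 * pi * (\sum_(i < 3) k 0 i * m 0 i)%:~R.
Proof.
rewrite /dot rmorph_sum mulr_sumr; apply: eq_bigr => i _.
by rewrite !mxE rmorphM /= mulrCA.
Qed.

Lemma dot_scaled_col k n (V : 'M[int]_(3, n)) i (t : R) :
  dot k (\row_j (2 * pi * t * (V j i)%:~R)) = 2 * pi * t * ((k *m V) 0 i)%:~R.
Proof.
rewrite /dot mxE rmorph_sum mulr_sumr; apply: eq_bigr => j _.
by rewrite !mxE rmorphM /= mulrCA.
Qed.

(** The differences [k - k0] are the rows of [A], brought to Smith form [L *m D *m U]. An elementary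
    divisor that is not a unit would yield a common phase; when all are units, the rows generate the
    whole lattice. *)
Lemma no_phase_Lambda_full (K : set 'rV[int]_3) k0 : finite_set K -> K k0 ->
  ~ (exists (x : pt) c, common_phase K x c) -> Lambda K = setT.
Proof.
move=> /finite_seqP[s Ks] Kk0 nophase.
(* Three zero rows, from the default [k0] of [nth], give [D] all three divisors. *)
pose N := (size s + 3)%N; have N3 : (3 <= N)%N by rewrite leq_addl.
pose A : 'M[int]_(N, 3) := \matrix_(j < N) (nth k0 s j - k0).
have LA j : Lambda K (row j A).
  rewrite rowK; apply: Lambda_sub => //.
  have [js|js] := ltnP j (size s); last by rewrite nth_default.
  by rewrite Ks /=; exact: mem_nth.
have [L uL [U uU [d _ AE]]] := int_Smith_normal_form A.
set D := (\matrix_(i, j) _) in AE.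
have du (i : 'I_3) : d`_i \is a GRing.unit.
  apply: contrapT => /negP dn; apply: nophase.
  (* [x] is dual to the i-th elementary divisor [d_i]; if [d_i = 0], half of the
     i-th dual vector will do. *)
  pose t : R := if d`_i == 0 then 2^-1 else (d`_i)%:~R^-1.
  pose x : pt := \row_j (2 * pi * t * (invmx U j i)%:~R).
  exists x, (mode k0 x); split; last split.
  (* Pairing with row [i] of [U] gives [2 * pi * t], so a period [x] would make [t] an integer; but
     [t] is one half or the inverse of a nonunit. *)
  - move=> [m xm].
    have : dot (row i U) x = 2 * pi * t.
      by rewrite dot_scaled_col -row_mul mulmxV // !mxE eqxx mulr1.
    rewrite xm dot_period; set c := \sum_(_ < _) _.
    move/(mulfI (lt0r_neq0 (two_pi_gt0 R))) => ct.
    move: dn; rewrite /t in ct; case: eqP ct => [_ ct|/eqP d0 ct].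
      have : (c * 2)%:~R = 1%:~R :> R by rewrite intrM ct mulVf.
      by move/intr_inj; lia.
    have /intr_inj cd : (c * d`_i)%:~R = 1%:~R :> R.
      by rewrite intrM ct mulVf ?intr_eq0.
    by rewrite (_ : _ \is a GRing.unit) //; apply/unitrPr; exists c; rewrite mulrC.
  - by rewrite /mode normc_def /= cos2Dsin2 sqrtr1.
  move=> k Kk.
  suff e1 : mode (k - k0) x = 1 by rewrite -[k](subrK k0) modeD e1 mul1r.
  have [j ->] : exists j, k - k0 = row j A.
    move: Kk; rewrite Ks /= => ks.
    have js : (index k s < N)%N by rewrite ltn_addr // index_mem.
    by exists (Ordinal js); rewrite rowK /= nth_index.
  (* On a row of [A] the phase is [2 * pi] times an integer times [t * d_i], and this last product
     is 0 or 1. *)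
  rewrite /mode dot_scaled_col -row_mul AE -!mulmxA mulmxV // mulmx1.
  have -> : row j (L *m D) 0 i = (\sum_m L j m *+ (m == i :> nat)) * d`_i.
    rewrite !mxE mulr_suml; apply: eq_bigr => m _; rewrite mxE.
    by case: eqP => [->|_]; rewrite ?mulr0n ?mulr0 ?mul0r.
  rewrite intrM -mulrA [t * _]mulrCA /t.
  case: eqP => [->|/eqP d0]; first by rewrite !mulr0 expi0.
  by rewrite mulVf ?intr_eq0 // mulr1 expi_2pi_int.
apply/seteqP; split=> // l _.
(* A left inverse of the rectangular diagonal matrix [D], integral because the divisors are
   units. *)
pose D' : 'M[int]_(3, N) := \matrix_(i, j) ((d`_i)^-1 *+ (i == j :> nat)).
have D'D : D' *m D = 1%:M.
  apply/matrixP => i j; rewrite !mxE (bigD1 (widen_ord N3 i)) //= big1 => [|m mi].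
    rewrite !mxE /= eqxx addr0 mulr1n.
    have [<-|ij] := eqVneq i j; first by rewrite eqxx mulr1n mulVr.
    have /negbTE -> : (i : nat) != j.
      by apply: contraNneq ij => ij; apply/eqP/val_inj.
    by rewrite mulr0n mulr0.
  have /negbTE im : (i : nat) != m.
    by apply: contraNneq mi => im; apply/eqP/val_inj.
  by rewrite !mxE im mulr0n mul0r.
(* This exhibits [l] as an integer combination of the rows of [A]. *)
have -> : l = (l *m invmx U *m D' *m invmx L) *m A.
  rewrite AE !mulmxA mulmxKV // -[_ *m D' *m D]mulmxA D'D mulmx1 mulmxKV //.
rewrite mulmx_sum_row; elim/big_ind : _ => [||j _].
- exact: span_over0.
- exact: LambdaD.
exact: LambdaZ.
Qed.

End CommonPhase.

Theorem theorem4p14 (R : realType) (K : set 'rV[int]_3)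
    (profiles : set ('rV[R]_3 -> R[i])) (k0 : 'rV[int]_3)
    (finK : finite_set K) (k0K : K k0)
    (fin_profiles : finite_set profiles)
    (phaseK : phase_complete (real_span profiles) K) :
  sat_limit (real_span profiles)
    = complex_span [set (mode l : 'rV[R]_3 -> R[i]) | l in coset K k0]
  /\ (forall s : R,
        Sobolev_closure s (sat_limit (real_span profiles))
          = Sobolev_supported s (coset K k0))
  /\ (cubic_saturating (real_span profiles) <-> Lambda K = setT)
  /\ (Lambda K = setT <->
        ~ exists (x : 'rV[R]_3) (c : R[i]), common_phase K x c)
  /\ (K 0 -> forall (x : 'rV[R]_3) (c : R[i]), common_phase K x c -> c = 1).
Proof.
have WE := sat_limit_trig k0K phaseK.
split; first exact: WE.
split; first by move=> s; rewrite WE; exact: Sobolev_closure_trig.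
split.
  rewrite /cubic_saturating WE Sobolev_closure_trig Sobolev_supported_all.
  exact: coset_setT.
split; last by move=> K0 x c; exact: common_phase0.
by split; [exact: Lambda_full_no_phase|exact: (no_phase_Lambda_full finK k0K)].
Qed.
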